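(* Let $L>0$ and let $f:\mathbb{R}\to\mathbb{R}$ be $2\pi$-periodic and $L$-Lipschitz. For $n\ge1$ let $p=f*\hat R_n$. Then $$\sup_{x\in\mathbb{R}}|f(x)-p(x)|\le\left(2\int_0^\pi\frac{\sin u}{u}\,du-\frac{4}{\pi}\right)\frac{L}{n}+O\left(\frac{1}{n^2}\right).$$ Moreover, equality is obtained when $f$ is the $2\pi$-periodic extension to $\mathbb{R}$ of the function $x\mapsto L|x|$ on $[-\pi,\pi]$; that is, for this $f$, $\sup_{x\in\mathbb{R}}|f(x)-p(x)|=\left(2\int_0^\pi\frac{\sin u}{u}\,du-\frac{4}{\pi}\right)\frac{L}{n}+O\left(\frac{1}{n^2}\right)$.
   Context: $L$-Lipschitz means $|f(x)-f(y)|\le L|x-y|$ for all $x,y\in\mathbb{R}$. For an integer $n\ge1$, Rivlin's kernel is $$R_n(t)=\left(\frac12+\sum_{j=1}^n\rho_{j,n}\cos(jt)\right)\cdot\mathbf{1}_{[-\pi,\pi]}(t),$$ where $$\rho_{j,n}=\frac{(n+2-j)\cos\left(\frac{j\pi}{n+2}\right)+\sin\left(\frac{j\pi}{n+2}\right)\cot\left(\frac{\pi}{n+2}\right)}{n+2},$$ and its normalization is $\hat R_n(t)=R_n(t)\big/\int_{\mathbb{R}}R_n(x)\,dx$. Convolution is $(f*g)(x)=\int_{\mathbb{R}}f(x-t)g(t)\,dt$. The $O(\cdot)$ is as $n\to\infty$, with implied constant depending only on $L$ (not otherwise on $f$). *)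

(* Defs.v *)
From Stdlib Require Import Reals.
From Coquelicot Require Import Coquelicot.
Open Scope R_scope.

Definition Lipschitz (L : R) (f : R -> R) : Prop :=
  forall x y : R, Rabs (f x - f y) <= L * Rabs (x - y).

Definition periodic_2PI (f : R -> R) : Prop :=
  forall x : R, f (x + 2 * PI) = f x.

(* This determines [f] uniquely; it is satisfiable exactly when
   [g (- PI) = g PI]. *)
Definition is_periodic_extension (g f : R -> R) : Prop :=
  periodic_2PI f /\ forall x : R, - PI <= x <= PI -> f x = g x.

(* Every integrand below is piecewise continuous and vanishes outside
   [- PI, PI], so the improper Riemann integral is the Lebesgue integral. *)
Definition integral_R (g : R -> R) : R :=
  RInt_gen g (Rbar_locally m_infty) (Rbar_locally p_infty).

Definition convolution (f g : R -> R) (x : R) : R :=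
  integral_R (fun t => f (x - t) * g t).

Definition indicator (a b t : R) : R :=
  if Rle_dec a t then (if Rle_dec t b then 1 else 0) else 0.

Definition cot (x : R) : R := cos x / sin x.

Definition rho (j n : nat) : R :=
  let N := INR n + 2 in
  ((N - INR j) * cos (INR j * PI / N) + sin (INR j * PI / N) * cot (PI / N)) / N.

Definition Rivlin (n : nat) (t : R) : R :=
  (1 / 2 + sum_n_m (fun j => rho j n * cos (INR j * t)) 1 n)
  * indicator (- PI) PI t.

Definition Rivlin_hat (n : nat) (t : R) : R :=
  Rivlin n t / integral_R (Rivlin n).

Definition sup_dist (f p : R -> R) : Rbar :=
  Lub_Rbar (fun y => exists x : R, y = Rabs (f x - p x)).

Definition bigO (E g : nat -> R) : Prop :=
  exists C : R, eventually (fun n => Rabs (E n) <= C * Rabs (g n)).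

(* The value of [sin u / u] at [u = 0] does not affect the integral. *)
Definition Rivlin_const : R :=
  2 * RInt (fun u => sin u / u) 0 PI - 4 / PI.

(* Main.v *)
Require Import Defs.
From Stdlib Require Import Reals ZArith Lra Lia.
From Coquelicot Require Import Coquelicot.
Open Scope R_scope.

(** Write [K] for the kernel on one period and [M] for its first absolute moment
    [(1 / PI) * integral of |t| K(t)] over [[-PI, PI]]. The kernel is nonnegative
    with mean [1] ([rivlin_kernel_nonneg], [is_RInt_cos_poly_total]), so
    [f(x) - p(x)], an average of [f(x) - f(x - t)], is at most [L M] in absolute
    value, with equality at [x = 0] for the triangle wave, which is itself
    [L]-Lipschitz ([convolution_error_le], [convolution_error_triangle],
    [triangle_wave_Lipschitz]). Both halves of the theorem thus hold with the
    same remainder [E n = L M - c L / n], and everything rests on the expansion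
    [M = c / n + O(1 / n ^ 2)], [c = 2 Si(PI) - 4 / PI]
    ([kernel_abs_moment_asymptotics]).

    Nonnegativity holds because [rho j n] is the autocorrelation of the sequence
    [sin (k h)], [h = PI / (n + 2)], which makes [K] the squared modulus of a
    trigonometric polynomial.

    For the expansion, integrating term by term gives
    [PI M = PI ^ 2 / 2 - 4 * sum of rho j n / j ^ 2] over odd [j <= n], that is,
    four times the sum of
    - [PI ^ 2 / 8] minus the sum of [1 / j ^ 2] over odd [j <= n], the tail of a
      series, which is [1 / (2 n) + O(1 / n ^ 2)];
    - the sum of [(1 - rho j n) / j ^ 2] over odd [j <= n]. Here [1 - rho j n] is
      [psi (j h) + O(h ^ 2)] for the fixed profile
      [psi u = 1 - (1 - u / PI) cos u - sin u / PI], so this is [h / 2] times a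
      midpoint sum of [psi u / u ^ 2] over [[0, PI]]. That function has an
      explicit primitive in terms of the sine integral
      ([odd_defect_sum_asymptotics]).

    That the inverse odd squares sum to [PI ^ 2 / 8] comes out of the same
    identity: [M] tends to [0], because [K] is nonnegative and the integral of
    [(1 - cos t) K(t)] is exactly [PI (1 - cos h)] ([kernel_abs_moment_bounds]),
    and the defect sum tends to [0] as well. *)

(** * Finite sums of real numbers *)

(** The laws of finite sums are restated over [R] with [+] and [*] in place of
    the operations of an abstract monoid or ring, so that [ring] and [lra] can
    work with the rewritten terms. *)
Lemma rsum_last (u : nat -> R) (n m : nat) :
  (n <= S m)%nat -> sum_n_m u n (S m) = sum_n_m u n m + u (S m).
Proof. exact (sum_n_Sm u n m). Qed.

Lemma rsum_first (u : nat -> R) (n m : nat) :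
  (n <= m)%nat -> sum_n_m u n m = u n + sum_n_m u (S n) m.
Proof. exact (sum_Sn_m u n m). Qed.

Lemma rsum_one (u : nat -> R) (n : nat) : sum_n_m u n n = u n.
Proof. exact (sum_n_n u n). Qed.

Lemma rsum_empty (u : nat -> R) (n m : nat) : (m < n)%nat -> sum_n_m u n m = 0.
Proof. exact (sum_n_m_zero (G := R_AbelianMonoid) u n m). Qed.

Lemma rsum_ext (u v : nat -> R) (n m : nat) :
  (forall k, (n <= k <= m)%nat -> u k = v k) -> sum_n_m u n m = sum_n_m v n m.
Proof. exact (sum_n_m_ext_loc (G := R_AbelianMonoid) u v n m). Qed.

Lemma rsum_shift (u : nat -> R) (n m : nat) :
  sum_n_m (fun k => u (S k)) n m = sum_n_m u (S n) (S m).
Proof. exact (sum_n_m_S (G := R_AbelianMonoid) u n m). Qed.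

Lemma rsum_scal (c : R) (u : nat -> R) (n m : nat) :
  sum_n_m (fun k => c * u k) n m = c * sum_n_m u n m.
Proof. exact (sum_n_m_mult_l (c : R_Ring) u n m). Qed.

Lemma rsum_plus (u v : nat -> R) (n m : nat) :
  sum_n_m (fun k => u k + v k) n m = sum_n_m u n m + sum_n_m v n m.
Proof. exact (sum_n_m_plus (G := R_AbelianMonoid) u v n m). Qed.

Lemma rsum_rev (u : nat -> R) (n : nat) :
  sum_n_m u 0 n = sum_n_m (fun k => u (n - k)%nat) 0 n.
Proof.
  induction n as [|n IH].
  - now rewrite !rsum_one.
  - rewrite rsum_last, IH by lia.
    rewrite (rsum_first (fun k => u (S n - k)%nat)) by lia.
    rewrite <- (rsum_shift (fun k => u (S n - k)%nat) 0 n).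
    replace (S n - 0)%nat with (S n) by lia.
    rewrite Rplus_comm; reflexivity.
Qed.

(** * Nonnegativity of Rivlin's kernel *)

Definition cos_poly (c : nat -> R) (n : nat) (t : R) : R :=
  1 / 2 + sum_n_m (fun j => c j * cos (INR j * t)) 1 n.

(** Both sides are [|sum_k a_k exp (i k t)|^2]: expanding the square, the
    products [a_k a_m] with [m - k = j] are those that multiply [cos (j t)]. *)
Lemma norm_trig_poly (a : nat -> R) (t : R) (n : nat) :
  (sum_n_m (fun k => a k * cos (INR k * t)) 0 n) ^ 2 +
  (sum_n_m (fun k => a k * sin (INR k * t)) 0 n) ^ 2 =
  sum_n_m (fun k => a k ^ 2) 0 n +
  2 * sum_n_m (fun j => cos (INR j * t) *
                        sum_n_m (fun m => a (m - j)%nat * a m) j n) 1 n.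
Proof.
  induction n as [|n IH].
  - rewrite !rsum_one, rsum_empty by lia.
    simpl INR. rewrite Rmult_0_l, cos_0, sin_0. ring.
  - rewrite !(rsum_last _ 0) by lia.
    rewrite (rsum_ext _
      (fun j => cos (INR j * t) * sum_n_m (fun m => a (m - j)%nat * a m) j n
                + a (S n) * (cos (INR j * t) * a (S n - j)%nat)) 1 (S n)).
    2:{ intros j Hj. rewrite rsum_last by lia. ring. }
    rewrite rsum_plus, rsum_scal.
    rewrite (rsum_last (fun j => cos (INR j * t) * _)) by lia.
    rewrite (rsum_empty _ (S n) n) by lia.
    rewrite <- (rsum_shift (fun j => cos (INR j * t) * a (S n - j)%nat) 0 n).
    (* The new products are those of [a (S n)] with [a k], at distance [S n - k];
       reversing the order of summation indexes them by [k]. *)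
    rewrite (rsum_rev (fun j => cos (INR (S j) * t) * a (S n - S j)%nat)).
    rewrite (rsum_ext
      (fun k => cos (INR (S (n - k)) * t) * a (S n - S (n - k))%nat)
      (fun k => cos (INR (S n) * t) * (a k * cos (INR k * t)) +
                sin (INR (S n) * t) * (a k * sin (INR k * t))) 0 n).
    2:{ intros k Hk. replace (S n - S (n - k))%nat with k by lia.
        replace (S (n - k)) with (S n - k)%nat by lia.
        rewrite minus_INR by lia.
        replace ((INR (S n) - INR k) * t) with (INR (S n) * t - INR k * t) by ring.
        rewrite cos_minus. ring. }
    rewrite rsum_plus, !rsum_scal.
    set (C := sum_n_m (fun k => a k * cos (INR k * t)) 0 n) in *.
    set (D := sum_n_m (fun k => a k * sin (INR k * t)) 0 n) in *.
    set (A := sum_n_m (fun k => a k ^ 2) 0 n) in *.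
    set (B := sum_n_m _ 1 n) in *.
    assert (Hsc := sin2_cos2 (INR (S n) * t)). unfold Rsqr in Hsc.
    set (s := sin _) in *. set (c := cos _) in *.
    replace (A + a (S n) ^ 2 + 2 * (B + c * 0 + a (S n) * (c * C + s * D)))
      with ((A + 2 * B) + a (S n) ^ 2 * 1 + 2 * a (S n) * (c * C + s * D)) by ring.
    rewrite <- IH, <- Hsc. ring.
Qed.

(** Each product of sines is half a difference of cosines. One of the two does
    not depend on the summation index, and the other telescopes after
    multiplication by [2 sin h]. *)
Lemma sine_autocorrelation (h : R) (j p : nat) :
  sin h <> 0 ->
  2 * sum_n_m (fun m => sin (INR (S (m - j)) * h) * sin (INR (S m) * h)) j (j + p) =
  INR (S p) * cos (INR j * h)
  - (sin ((2 * INR p + INR j + 3) * h) - sin ((INR j + 1) * h)) / (2 * sin h).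
Proof.
  intros Hh.
  assert (Hterm : forall q : nat,
    2 * (sin (INR (S q) * h) * sin (INR (S (j + q)) * h)) =
    cos (INR j * h) - (sin ((2 * INR q + INR j + 3) * h)
                       - sin ((2 * INR q + INR j + 1) * h)) / (2 * sin h)).
  { intros q. rewrite !S_INR, plus_INR.
    set (x := (INR q + 1) * h). set (y := (INR j + INR q + 1) * h).
    replace (INR j * h) with (y - x) by (unfold x, y; ring).
    replace ((2 * INR q + INR j + 3) * h) with ((x + y) + h) by (unfold x, y; ring).
    replace ((2 * INR q + INR j + 1) * h) with ((x + y) - h) by (unfold x, y; ring).
    rewrite sin_plus, sin_minus, cos_minus, cos_plus. field. exact Hh. }
  induction p as [|p IH].
  - rewrite Nat.add_0_r, rsum_one.
    assert (H := Hterm 0%nat). rewrite Nat.add_0_r in H.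
    replace (j - j)%nat with 0%nat by lia. rewrite H. simpl INR.
    replace (2 * 0 + INR j + 1) with (INR j + 1) by ring. ring.
  - replace (j + S p)%nat with (S (j + p)) by lia.
    rewrite rsum_last by lia.
    rewrite Rmult_plus_distr_l, IH.
    replace (S (j + p) - j)%nat with (S p) by lia.
    assert (H := Hterm (S p)).
    replace (j + S p)%nat with (S (j + p)) in H by lia.
    rewrite H, !S_INR.
    replace (2 * (INR p + 1) + INR j + 1) with (2 * INR p + INR j + 3) by ring.
    field. exact Hh.
Qed.

Definition mesh (n : nat) : R := PI / (INR n + 2).

Lemma mesh_spec (n : nat) : (INR n + 2) * mesh n = PI.
Proof. unfold mesh. assert (Hn := pos_INR n). field. lra. Qed.

Lemma sin_mesh_pos (n : nat) : 0 < sin (mesh n).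
Proof.
  unfold mesh. assert (HP := PI_RGT_0). assert (Hn := pos_INR n).
  apply sin_gt_0.
  - apply Rdiv_lt_0_compat; lra.
  - apply (Rmult_lt_reg_r (INR n + 2)); [lra|]. field_simplify; nra.
Qed.

(** This explains the formula for [rho]: up to normalization, [rho j n] is the
    autocorrelation at distance [j] of the sequence [sin h, sin 2h, ...,
    sin (n+1)h] with [h = PI / (n+2)]. *)
Lemma rho_autocorrelation (n j : nat) :
  (j <= n)%nat ->
  sum_n_m (fun m => sin (INR (S (m - j)) * mesh n) * sin (INR (S m) * mesh n)) j n =
  (INR n + 2) / 2 * rho j n.
Proof.
  intros Hj. set (h := mesh n).
  assert (Hn := pos_INR n).
  assert (Hs : 0 < sin h) by apply sin_mesh_pos.
  assert (H := sine_autocorrelation h j (n - j) ltac:(lra)).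
  replace (j + (n - j))%nat with n in H by lia.
  apply (Rmult_eq_reg_l 2); [|lra]. rewrite H.
  rewrite S_INR, minus_INR by lia.
  (* Since [(n + 2) h = PI], the upper end of the telescoping sum mirrors the
     lower one. *)
  replace ((2 * (INR n - INR j) + INR j + 3) * h)
    with (- ((INR j + 1) * h) + 2 * PI) by (unfold h, mesh; field; lra).
  rewrite (sin_plus _ (2 * PI)), sin_2PI, cos_2PI, sin_neg.
  replace ((INR j + 1) * h) with (INR j * h + h) by ring.
  rewrite sin_plus. unfold rho, cot.
  replace (INR j * PI / (INR n + 2)) with (INR j * h) by (unfold h, mesh; field; lra).
  fold (mesh n). fold h. field. lra.
Qed.

(** [(n + 2)] times the kernel is the squared modulus of the trigonometric
    polynomial whose coefficients are the sines above. *)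
Lemma rivlin_kernel_nonneg (n : nat) (t : R) :
  0 <= cos_poly (fun j => rho j n) n t.
Proof.
  assert (Hn := pos_INR n).
  set (h := mesh n).
  set (a := fun k : nat => sin (INR (S k) * h)).
  assert (Hrho : forall j, (j <= n)%nat ->
    sum_n_m (fun m => a (m - j)%nat * a m) j n = (INR n + 2) / 2 * rho j n)
    by (intros j Hj; exact (rho_autocorrelation n j Hj)).
  assert (Hrho0 : rho 0 n = 1).
  { unfold rho. simpl INR.
    replace (0 * PI / (INR n + 2)) with 0 by (field; lra).
    rewrite cos_0, sin_0. field. lra. }
  assert (H := norm_trig_poly a t n).
  rewrite (rsum_ext (fun k => a k ^ 2) (fun m => a (m - 0)%nat * a m) 0 n) in H
    by (intros k _; rewrite Nat.sub_0_r; simpl; ring).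
  rewrite (Hrho 0%nat), Hrho0 in H by lia.
  rewrite (rsum_ext
    (fun j => cos (INR j * t) * sum_n_m (fun m => a (m - j)%nat * a m) j n)
    (fun j => (INR n + 2) / 2 * (rho j n * cos (INR j * t))) 1 n) in H
    by (intros j Hj; rewrite Hrho by lia; ring).
  rewrite rsum_scal in H.
  unfold cos_poly. set (S := sum_n_m _ 1 n) in *.
  apply (Rmult_le_reg_l (INR n + 2)); [lra|].
  assert (H1 := pow2_ge_0 (sum_n_m (fun k => a k * cos (INR k * t)) 0 n)).
  assert (H2 := pow2_ge_0 (sum_n_m (fun k => a k * sin (INR k * t)) 0 n)).
  lra.
Qed.

(** * Moments of cosine polynomials *)

(** As for sums, integrals are brought down from abstract normed modules to
    [R]. *)
Lemma is_RInt_ext_R (f g : R -> R) (a b v : R) :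
  (forall x, Rmin a b < x < Rmax a b -> f x = g x) ->
  is_RInt f a b v -> is_RInt g a b v.
Proof. exact (is_RInt_ext (V := R_NormedModule) f g a b v). Qed.

Lemma is_RInt_plus_R (f g : R -> R) (a b v w : R) :
  is_RInt f a b v -> is_RInt g a b w -> is_RInt (fun x => f x + g x) a b (v + w).
Proof. exact (is_RInt_plus (V := R_NormedModule) f g a b v w). Qed.

Lemma is_RInt_scal_R (f : R -> R) (a b c v : R) :
  is_RInt f a b v -> is_RInt (fun x => c * f x) a b (c * v).
Proof. exact (is_RInt_scal (V := R_NormedModule) f a b c v). Qed.

Lemma is_RInt_antiderivative (F f : R -> R) (a b : R) :
  (forall x, is_derive F x (f x)) -> (forall x, continuous f x) ->
  is_RInt f a b (F b - F a).
Proof.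
  intros HF Hf. apply (is_RInt_derive (V := R_CompleteNormedModule)); auto.
Qed.

Lemma is_RInt_even (f : R -> R) (a v : R) :
  (forall t, f (- t) = f t) -> is_RInt f 0 a v -> is_RInt f (- a) a (2 * v).
Proof.
  intros Hf Hv.
  replace (2 * v) with (plus v v) by (unfold plus; simpl; ring).
  apply (is_RInt_Chasles (V := R_NormedModule) f (- a) 0 a); [|exact Hv].
  assert (H : is_RInt (fun y => opp (f (- y))) 0 (- a) v).
  { apply (is_RInt_comp_opp (V := R_NormedModule)).
    now rewrite Ropp_0, Ropp_involutive. }
  apply (is_RInt_swap (V := R_NormedModule)) in H.
  apply (is_RInt_opp (V := R_NormedModule)) in H.
  rewrite opp_opp in H.
  apply (is_RInt_ext_R (fun y => opp (opp (f (- y))))); [|exact H].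
  intros t _. rewrite opp_opp. apply Hf.
Qed.

Lemma sin_INR_PI (k : nat) : sin (INR k * PI) = 0.
Proof.
  apply sin_eq_0_1. exists (Z.of_nat k). now rewrite <- INR_IZR_INZ.
Qed.

(** With [j = 0] allowed in the hypothesis, [I 0] is the integral of the weight
    itself, which accounts for the constant term [1 / 2]. *)
Lemma is_RInt_cos_poly (w : R -> R) (c I : nat -> R) (n : nat) (a b : R) :
  (forall j, is_RInt (fun t => w t * cos (INR j * t)) a b (I j)) ->
  is_RInt (fun t => w t * cos_poly c n t) a b
          (I 0%nat / 2 + sum_n_m (fun j => c j * I j) 1 n).
Proof.
  intros HI.
  assert (Hsum : is_RInt (fun t => w t * sum_n_m (fun j => c j * cos (INR j * t)) 1 n)
                         a b (sum_n_m (fun j => c j * I j) 1 n)).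
  { induction n as [|n IH].
    - rewrite rsum_empty by lia.
      apply (is_RInt_ext_R (fun t => 0 * (w t * cos (INR 0 * t)))).
      { intros t _. rewrite rsum_empty by lia. ring. }
      assert (H0 := is_RInt_scal_R _ a b 0 _ (HI 0%nat)).
      rewrite (Rmult_0_l (I 0%nat)) in H0. exact H0.
    - rewrite rsum_last by lia.
      apply (is_RInt_ext_R (fun t =>
        w t * sum_n_m (fun j => c j * cos (INR j * t)) 1 n
        + c (S n) * (w t * cos (INR (S n) * t)))).
      { intros t _. rewrite rsum_last by lia. ring. }
      apply is_RInt_plus_R; [exact IH|].
      apply is_RInt_scal_R; exact (HI (S n)). }
  apply (is_RInt_ext_R (fun t => 1 / 2 * (w t * cos (INR 0 * t))
           + w t * sum_n_m (fun j => c j * cos (INR j * t)) 1 n)).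
  { intros t _. unfold cos_poly. simpl INR. rewrite Rmult_0_l, cos_0. field. }
  replace (I 0%nat / 2) with (1 / 2 * I 0%nat) by field.
  apply is_RInt_plus_R; [|exact Hsum].
  apply is_RInt_scal_R; exact (HI 0%nat).
Qed.

Ltac continuity_by_derivative :=
  intros; apply (ex_derive_continuous (V := R_NormedModule)); auto_derive; auto.

Lemma is_RInt_cos_mode (j : nat) :
  is_RInt (fun t => cos (INR j * t)) (- PI) PI
          (match j with O => 2 * PI | _ => 0 end).
Proof.
  destruct j as [|k].
  - apply (is_RInt_ext_R (fun _ => 1)).
    { intros; simpl INR; now rewrite Rmult_0_l, cos_0. }
    replace (2 * PI) with ((fun x => x) PI - (fun x => x) (- PI)) by (simpl; ring).
    apply (is_RInt_antiderivative (fun x => x)).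
    + intros x. auto_derive; auto.
    + continuity_by_derivative.
  - assert (Hk : INR (S k) <> 0) by (apply not_0_INR; lia).
    set (m := INR (S k)) in *.
    replace 0 with (sin (m * PI) / m - sin (m * (- PI)) / m).
    2:{ rewrite Ropp_mult_distr_r_reverse, sin_neg. unfold m.
        rewrite sin_INR_PI. unfold m in Hk. field. exact Hk. }
    apply (is_RInt_antiderivative (fun x => sin (m * x) / m)).
    + intros x. auto_derive; auto. field. exact Hk.
    + continuity_by_derivative.
Qed.

Lemma is_RInt_cos_poly_total (c : nat -> R) (n : nat) :
  is_RInt (cos_poly c n) (- PI) PI PI.
Proof.
  assert (H := is_RInt_cos_poly (fun _ => 1) c
                 (fun j => match j with O => 2 * PI | _ => 0 end) n (- PI) PI).
  rewrite (rsum_ext _ (fun j => 0 * c j)) in H by (intros [|j] Hj; [lia|ring]).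
  rewrite rsum_scal in H.
  replace (2 * PI / 2 + 0 * sum_n_m c 1 n) with PI in H by field.
  apply (is_RInt_ext_R (fun t => 1 * cos_poly c n t)); [intros; apply Rmult_1_l|].
  apply H. intros j.
  apply (is_RInt_ext_R (fun t => cos (INR j * t))); [intros; ring|].
  apply is_RInt_cos_mode.
Qed.

(** Only the mode [j = 1] is not orthogonal to [cos]. *)
Lemma is_RInt_cos_poly_cos (c : nat -> R) (n : nat) :
  (1 <= n)%nat ->
  is_RInt (fun t => cos t * cos_poly c n t) (- PI) PI (PI * c 1%nat).
Proof.
  intros Hn.
  assert (H := is_RInt_cos_poly cos c
                 (fun j => match j with 1%nat => PI | _ => 0 end) n (- PI) PI).
  rewrite rsum_first in H by lia.
  rewrite (rsum_ext _ (fun j => 0 * c j) 2) in H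
    by (intros [|[|j]] Hj; [lia|lia|ring]).
  rewrite rsum_scal in H.
  replace (0 / 2 + (c 1%nat * PI + 0 * sum_n_m c 2 n)) with (PI * c 1%nat) in H by field.
  apply H. intros j.
  (* [m] is [|j - 1|], so that [2 cos t cos (j t) = cos (m t) + cos ((j+1) t)]. *)
  set (m := match j with O => 1%nat | S i => i end).
  assert (Hval : (match j with 1%nat => PI | _ => 0 end : R) =
                 1 / 2 * (match m with O => 2 * PI | _ => 0 end) +
                 1 / 2 * (match S j with O => 2 * PI | _ => 0 end)).
  { unfold m. destruct j as [|[|j]]; field. }
  rewrite Hval.
  apply (is_RInt_ext_R (fun t => 1 / 2 * cos (INR m * t) + 1 / 2 * cos (INR (S j) * t))).
  { intros t _. rewrite (S_INR j). 
    assert (Hm : cos (INR m * t) = cos (INR j * t - t)).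
    { unfold m. destruct j as [|i].
      - simpl INR. replace (0 * t - t) with (- (1 * t)) by ring. now rewrite cos_neg.
      - rewrite S_INR. f_equal; ring. }
    rewrite Hm. replace ((INR j + 1) * t) with (INR j * t + t) by ring.
    rewrite cos_minus, cos_plus. field. }
  apply is_RInt_plus_R.
  - apply is_RInt_scal_R; exact (is_RInt_cos_mode m).
  - apply is_RInt_scal_R; exact (is_RInt_cos_mode (S j)).
Qed.

Lemma is_RInt_abs_cos_mode (j : nat) :
  is_RInt (fun t => Rabs t * cos (INR j * t)) (- PI) PI
          (2 * match j with O => PI ^ 2 / 2 | _ => (cos (INR j * PI) - 1) / INR j ^ 2 end).
Proof.
  assert (HP := PI_RGT_0).
  apply is_RInt_even.
  { intros t. rewrite Rabs_Ropp, Ropp_mult_distr_r_reverse, cos_neg. reflexivity. }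
  apply (is_RInt_ext_R (fun t => t * cos (INR j * t))).
  { intros t Ht. rewrite Rmin_left, Rmax_right in Ht by lra. rewrite Rabs_pos_eq; lra. }
  destruct j as [|k].
  - replace (PI ^ 2 / 2) with (PI ^ 2 / 2 - 0 ^ 2 / 2) by field.
    apply (is_RInt_antiderivative (fun x => x ^ 2 / 2)).
    + intros x. auto_derive; auto. simpl INR. rewrite Rmult_0_l, cos_0. field.
    + continuity_by_derivative.
  - assert (Hk : INR (S k) <> 0) by (apply not_0_INR; lia).
    assert (Hs := sin_INR_PI (S k)).
    set (m := INR (S k)) in *.
    replace ((cos (m * PI) - 1) / m ^ 2) with
      ((PI * sin (m * PI) / m + cos (m * PI) / m ^ 2) -
       (0 * sin (m * 0) / m + cos (m * 0) / m ^ 2)).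
    2:{ rewrite Hs, (Rmult_0_r m), cos_0. field. exact Hk. }
    apply (is_RInt_antiderivative (fun x => x * sin (m * x) / m + cos (m * x) / m ^ 2)).
    + intros x. auto_derive; auto. field. exact Hk.
    + continuity_by_derivative.
Qed.

Lemma cos_even_PI (k : nat) : cos (INR (2 * k) * PI) = 1.
Proof.
  rewrite mult_INR. simpl (INR 2). replace ((1 + 1) * INR k * PI) with (0 + 2 * INR k * PI) by ring.
  rewrite cos_period. apply cos_0.
Qed.

Lemma cos_odd_PI (k : nat) : cos (INR (2 * k + 1) * PI) = -1.
Proof.
  rewrite plus_INR. simpl (INR 1). rewrite Rmult_plus_distr_r, Rmult_1_l, neg_cos, cos_even_PI. ring.
Qed.

(** [1 - cos (j PI)] is [2] for odd [j] and [0] for even [j]. The last odd index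
    not exceeding [n] is [2q + 1], whatever the parity of [n]. *)
Lemma rsum_odd_modes (d : nat -> R) (n q : nat) :
  (2 * q + 1 <= n <= 2 * q + 2)%nat ->
  @eq R (sum_n_m (fun j => (1 - cos (INR j * PI)) * d j) 1 n)
  (2 * sum_n_m (fun k => d (2 * k + 1)%nat) 0 q).
Proof.
  intros Hn.
  assert (Hstep : forall p, (1 - cos (INR (S (2 * p + 1)) * PI)) * d (S (2 * p + 1)) = 0).
  { intros p. replace (S (2 * p + 1)) with (2 * S p)%nat by lia.
    rewrite cos_even_PI. ring. }
  assert (Hodd : @eq R (sum_n_m (fun j => (1 - cos (INR j * PI)) * d j) 1 (2 * q + 1))
                 (2 * sum_n_m (fun k => d (2 * k + 1)%nat) 0 q)).
  { clear Hn. induction q as [|q IH].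
    - assert (H0 := cos_odd_PI 0). simpl Nat.mul in *. simpl Nat.add in *.
      rewrite !rsum_one, H0. simpl Nat.mul. simpl Nat.add. ring.
    - replace (2 * S q + 1)%nat with (S (S (2 * q + 1))) at 1 by lia.
      rewrite !rsum_last by lia. rewrite IH, Hstep.
      replace (S (S (2 * q + 1))) with (2 * S q + 1)%nat by lia.
      rewrite cos_odd_PI. ring. }
  assert (Hcase : n = (2 * q + 1)%nat \/ n = S (2 * q + 1)) by lia.
  destruct Hcase as [-> | ->]; [exact Hodd|].
  rewrite rsum_last, Hstep, Hodd by lia. ring.
Qed.

Lemma is_RInt_cos_poly_abs (c : nat -> R) (n q : nat) :
  (2 * q + 1 <= n <= 2 * q + 2)%nat ->
  is_RInt (fun t => Rabs t * cos_poly c n t) (- PI) PI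
    (PI ^ 2 / 2 - 4 * sum_n_m (fun k => c (2 * k + 1)%nat / INR (2 * k + 1) ^ 2) 0 q).
Proof.
  intros Hn.
  assert (H := is_RInt_cos_poly Rabs c
    (fun j => 2 * match j with O => PI ^ 2 / 2 | _ => (cos (INR j * PI) - 1) / INR j ^ 2 end)
    n (- PI) PI is_RInt_abs_cos_mode).
  rewrite (rsum_ext _ (fun j => -2 * ((1 - cos (INR j * PI)) * (c j / INR j ^ 2)))) in H.
  2:{ intros [|j] Hj; [lia|]. field. apply not_0_INR; lia. }
  rewrite rsum_scal, (rsum_odd_modes _ n q Hn) in H.
  match type of H with is_RInt _ _ _ ?v => match goal with |- is_RInt _ _ _ ?w =>
    replace w with v by field end end.
  exact H.
Qed.

(** * Elementary inequalities *)

Lemma mean_value (F F' : R -> R) (a b : R) :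
  a <= b -> (forall x, a <= x <= b -> is_derive F x (F' x)) ->
  exists c, a <= c <= b /\ F b - F a = F' c * (b - a).
Proof.
  intros Hab HF.
  destruct (MVT_gen F a b F') as [c [Hc E]].
  - intros x Hx. rewrite Rmin_left, Rmax_right in Hx by lra. apply HF; lra.
  - intros x Hx. rewrite Rmin_left, Rmax_right in Hx by lra.
    apply continuity_pt_filterlim, (ex_derive_continuous (V := R_NormedModule)).
    exists (F' x). apply HF; lra.
  - rewrite Rmin_left, Rmax_right in Hc by lra. now exists c.
Qed.

(** A crude substitute for integrating the bound on the derivative: the factor
    [1 / (k + 1)] is lost, which is harmless in an estimate up to constants. It
    can be iterated. *)
Lemma power_bound_from_derivative (F F' : R -> R) (a u : R) (k : nat) :
  0 <= a -> 0 <= u -> F 0 = 0 ->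
  (forall s, 0 <= s <= u -> is_derive F s (F' s)) ->
  (forall s, 0 <= s <= u -> Rabs (F' s) <= a * s ^ k) ->
  Rabs (F u) <= a * u ^ S k.
Proof.
  intros Ha Hu H0 HF Hbd.
  destruct (mean_value F F' 0 u Hu HF) as [c [Hc E]].
  rewrite H0, !Rminus_0_r in E. rewrite E, Rabs_mult, (Rabs_pos_eq u) by lra.
  simpl pow. rewrite (Rmult_comm u), <- Rmult_assoc.
  apply Rmult_le_compat_r; [lra|].
  apply Rle_trans with (a * c ^ k); [apply Hbd; lra|].
  apply Rmult_le_compat_l; [lra|]. apply pow_incr; lra.
Qed.

Lemma abs_sin_le (u : R) : 0 <= u -> Rabs (sin u) <= u.
Proof.
  intros Hu. replace u with (1 * u ^ 1) at 2 by ring.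
  apply (power_bound_from_derivative sin cos); try lra.
  - apply sin_0.
  - intros s _. auto_derive; auto. ring.
  - intros s _. simpl. rewrite Rmult_1_r. apply Rabs_le. apply COS_bound.
Qed.

Lemma one_minus_cos_le (u : R) : 0 <= u -> Rabs (1 - cos u) <= u ^ 2.
Proof.
  intros Hu. replace (u ^ 2) with (1 * u ^ 2) by ring.
  apply (power_bound_from_derivative (fun u => 1 - cos u) sin); try lra.
  - rewrite cos_0; ring.
  - intros s _. auto_derive; auto. ring.
  - intros s Hs. replace (1 * s ^ 1) with s by ring. apply abs_sin_le; lra.
Qed.

Lemma one_minus_cos_le_id (u : R) : 0 <= u -> Rabs (1 - cos u) <= u.
Proof.
  intros Hu. replace u with (1 * u ^ 1) at 2 by ring.
  apply (power_bound_from_derivative (fun u => 1 - cos u) sin); try lra.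
  - rewrite cos_0; ring.
  - intros s _. auto_derive; auto. ring.
  - intros s Hs. simpl. rewrite Rmult_1_r. apply Rabs_le. apply SIN_bound.
Qed.

Lemma sin_ge_quarter (x : R) : 0 <= x <= PI / 2 -> x / 4 <= sin x.
Proof.
  intros Hx. assert (HP := PI_RGT_0). assert (HP4 := PI_4).
  destruct (Rle_dec x (PI / 3)) as [H3|H3].
  - destruct (mean_value sin cos 0 x) as [c [Hc E]]; [lra| |].
    + intros s _. auto_derive; auto. ring.
    + rewrite sin_0, !Rminus_0_r in E.
      assert (1 / 2 <= cos c).
      { rewrite <- cos_PI3. apply cos_decr_1; lra. }
      nra.
  - assert (1 / 2 <= sin x).
    { rewrite <- sin_PI6. apply sin_incr_1; lra. }
    lra.
Qed.

(** Comparison of [t ^ 2] with [1 - cos t] on a period, through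
    [1 - cos t = 2 (sin (t/2))^2]. It turns the exactly computable moment of
    [1 - cos t] into a bound on the second moment. *)
Lemma sqr_le_one_minus_cos (t : R) : - PI <= t <= PI -> t ^ 2 <= 32 * (1 - cos t).
Proof.
  assert (Hpos : forall s, 0 <= s <= PI -> s ^ 2 <= 32 * (1 - cos s)).
  { intros s Hs. assert (H := sin_ge_quarter (s / 2) ltac:(lra)).
    replace s with (2 * (s / 2)) at 2 by field.
    rewrite cos_2a_sin. nra. }
  intros Ht. destruct (Rle_dec 0 t).
  - apply Hpos; lra.
  - replace (t ^ 2) with ((- t) ^ 2) by ring. rewrite <- cos_neg. apply Hpos; lra.
Qed.

Lemma cot_expansion (h : R) :
  0 < h <= PI / 2 -> Rabs (h * cot h - 1) <= 4 * h ^ 2.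
Proof.
  intros Hh.
  assert (Hs := sin_ge_quarter h ltac:(lra)).
  assert (Hn : Rabs (h * cos h - sin h) <= 1 * h ^ 3).
  { apply (power_bound_from_derivative (fun u => u * cos u - sin u) (fun u => - (u * sin u)));
      try lra.
    - rewrite sin_0; ring.
    - intros s _. auto_derive; auto. ring.
    - intros s Hs'. rewrite Rabs_Ropp, Rabs_mult, (Rabs_pos_eq s) by lra.
      assert (H := abs_sin_le s ltac:(lra)). simpl. nra. }
  replace (h * cot h - 1) with ((h * cos h - sin h) / sin h) by (unfold cot; field; lra).
  unfold Rdiv. rewrite Rabs_mult, (Rabs_pos_eq (/ sin h)).
  2:{ left; apply Rinv_0_lt_compat; lra. }
  apply (Rmult_le_reg_r (sin h)); [lra|].
  rewrite Rmult_assoc, Rinv_l, Rmult_1_r by lra.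
  apply Rle_trans with (4 * h ^ 2 * (h / 4)); [lra|].
  apply Rmult_le_compat_l; [nra|lra].
Qed.

(** * The sine integral *)

(** The value at [0] makes the function continuous. *)
Definition sinc (u : R) : R := if Req_EM_T u 0 then 1 else sin u / u.

Lemma sinc_neq0 (u : R) : u <> 0 -> sinc u = sin u / u.
Proof. intros Hu. unfold sinc. now destruct (Req_EM_T u 0). Qed.

(** Continuity at [0] is the statement that [sin] has derivative [1] there. *)
Lemma continuous_sinc (u : R) : continuous sinc u.
Proof.
  destruct (Req_EM_T u 0) as [->|Hu].
  - apply continuity_pt_filterlim. intros e He.
    destruct (derivable_pt_lim_sin_0 e He) as [d Hd].
    exists d. split; [apply cond_pos|].
    intros x [[_ Hx] Hdx]. simpl in *. unfold Rdist in *.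
    rewrite Rminus_0_r in Hdx.
    specialize (Hd x (not_eq_sym Hx) Hdx).
    rewrite Rplus_0_l, sin_0, Rminus_0_r in Hd.
    rewrite (sinc_neq0 x) by auto. unfold sinc.
    destruct (Req_EM_T 0 0); [exact Hd|lra].
  - apply (continuous_ext_loc _ (fun x => sin x / x)).
    + assert (Hp : 0 < Rabs u) by now apply Rabs_pos_lt.
      exists (mkposreal _ Hp). intros y Hy.
      symmetry; apply sinc_neq0. intros ->.
      change (Rabs (0 - u) < Rabs u) in Hy.
      rewrite Rminus_0_l, Rabs_Ropp in Hy. lra.
    + apply (ex_derive_continuous (V := R_NormedModule)). auto_derive; auto.
Qed.

Definition Si (u : R) : R := RInt sinc 0 u.

Lemma is_derive_Si (u : R) : is_derive Si u (sinc u).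
Proof.
  apply (is_derive_RInt (V := R_NormedModule) sinc Si 0 u).
  - exists (mkposreal 1 Rlt_0_1). intros b _.
    apply (RInt_correct (V := R_CompleteNormedModule)).
    apply (ex_RInt_continuous (V := R_CompleteNormedModule)).
    intros; apply continuous_sinc.
  - apply continuous_sinc.
Qed.

Lemma Si_bound (u : R) : 0 <= u -> Rabs (Si u) <= u.
Proof.
  intros Hu. replace u with (1 * u ^ 1) at 2 by ring.
  apply (power_bound_from_derivative Si sinc); try lra.
  - apply (RInt_point (V := R_CompleteNormedModule)).
  - intros; apply is_derive_Si.
  - intros s Hs. simpl. rewrite Rmult_1_r.
    destruct (Req_EM_T s 0) as [->|Hs0].
    + unfold sinc. destruct (Req_EM_T 0 0); [rewrite Rabs_R1; lra|lra].
    + rewrite sinc_neq0 by auto. unfold Rdiv. rewrite Rabs_mult, Rabs_inv, (Rabs_pos_eq s) by lra.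
      apply (Rmult_le_reg_r s); [lra|].
      rewrite Rmult_assoc, Rinv_l, Rmult_1_r, Rmult_1_l by lra.
      apply abs_sin_le; lra.
Qed.

Lemma Rivlin_const_Si : Rivlin_const = 2 * Si PI - 4 / PI.
Proof.
  unfold Rivlin_const, Si. assert (HP := PI_RGT_0).
  rewrite (RInt_ext (V := R_CompleteNormedModule) (fun u => sin u / u) sinc); [reflexivity|].
  intros x Hx. rewrite Rmin_left, Rmax_right in Hx by lra.
  symmetry; apply sinc_neq0; lra.
Qed.

(** * The limit profile of the coefficients *)

(** With [u = j h], this is [1 - rho j n] in the limit where [h cot h] is
    replaced by [1]. *)
Definition rho_defect (u : R) : R := 1 - (1 - u / PI) * cos u - sin u / PI.

(** The term [(1 - rho j n) / j ^ 2] is [h ^ 2] times this ratio at [j h], up to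
    the error made by replacing [h cot h] by [1]. *)
Definition defect_ratio (u : R) : R := rho_defect u / u ^ 2.

(** A primitive of [defect_ratio], from integration by parts: [rho_defect] has
    derivative [(1 - u / PI) sin u], so what remains to integrate is
    [sin u / u - sin u / PI]. This is where the sine integral enters. It tends
    to [0] at [0]. *)
Definition defect_primitive (u : R) : R :=
  (- rho_defect u / u - (1 - cos u) / PI) + Si u.

Lemma is_derive_rho_defect (u : R) :
  is_derive rho_defect u ((1 - u / PI) * sin u).
Proof.
  assert (HP := PI_RGT_0). unfold rho_defect. auto_derive; auto. field. lra.
Qed.

Lemma unit_weight (u : R) : 0 <= u <= PI -> 0 <= 1 - u / PI <= 1.
Proof.
  intros Hu. assert (HP := PI_RGT_0).
  assert (0 <= u / PI) by (apply Rdiv_le_0_compat; lra).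
  assert (u / PI <= 1).
  { apply (Rmult_le_reg_r PI); [lra|]. unfold Rdiv. rewrite Rmult_assoc, Rinv_l; lra. }
  lra.
Qed.

Lemma rho_defect_bound (u : R) : 0 <= u <= PI -> Rabs (rho_defect u) <= u ^ 2.
Proof.
  intros Hu. replace (u ^ 2) with (1 * u ^ 2) by ring.
  apply (power_bound_from_derivative rho_defect (fun u => (1 - u / PI) * sin u)); try lra.
  - unfold rho_defect. rewrite sin_0, cos_0. assert (HP := PI_RGT_0). field. lra.
  - intros; apply is_derive_rho_defect.
  - intros s Hs. assert (Hw := unit_weight s ltac:(lra)).
    assert (H := abs_sin_le s ltac:(lra)). assert (H0 := Rabs_pos (sin s)).
    rewrite Rabs_mult, (Rabs_pos_eq (1 - s / PI)) by lra. simpl. nra.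
Qed.

Lemma defect_ratio_bound (u : R) : 0 < u <= PI -> Rabs (defect_ratio u) <= 1.
Proof.
  intros Hu. unfold defect_ratio, Rdiv.
  assert (Hp : 0 < u ^ 2) by nra.
  rewrite Rabs_mult, Rabs_inv, (Rabs_pos_eq (u ^ 2)) by lra.
  apply (Rmult_le_reg_r (u ^ 2)); [lra|].
  rewrite Rmult_assoc, Rinv_l, Rmult_1_r, Rmult_1_l by lra.
  apply rho_defect_bound; lra.
Qed.

(** The quotient is the derivative of [defect_ratio]. Its numerator vanishes to
    third order at [0]; [dchi] is the derivative of the numerator, and the
    second derivative is [u] times a bounded function. *)
Lemma defect_ratio_derivative_bound (u : R) :
  0 < u <= PI ->
  Rabs ((u * ((1 - u / PI) * sin u) - 2 * rho_defect u) / u ^ 3) <= 2.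
Proof.
  intros Hu. assert (HP := PI_RGT_0). assert (HP3 : 2 <= PI) by (assert (H := PI2_1); lra).
  set (dchi := fun s => s * ((1 - s / PI) * cos s - sin s / PI) - (1 - s / PI) * sin s).
  assert (Hd : forall s, 0 <= s <= PI -> Rabs (dchi s) <= 2 * s ^ 2).
  { intros s Hs.
    apply (power_bound_from_derivative dchi
             (fun s => s * (- (1 - s / PI) * sin s - 2 * cos s / PI))); try lra.
    - unfold dchi. rewrite sin_0. ring.
    - intros r _. unfold dchi. auto_derive; auto. field. lra.
    - intros r Hr. assert (Hw := unit_weight r ltac:(lra)).
      rewrite Rabs_mult, (Rabs_pos_eq r), Rmult_comm by lra. rewrite pow_1.
      apply Rmult_le_compat_r; [lra|].
      assert (Hc := COS_bound r). assert (Hs1 := SIN_bound r).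
      assert (Hq : -1 <= 2 * cos r / PI <= 1).
      { split; apply (Rmult_le_reg_r PI); try lra; unfold Rdiv;
          rewrite ?(Rmult_assoc (2 * cos r)), Rinv_l; lra. }
      apply Rabs_le. nra. }
  assert (Hchi : Rabs (u * ((1 - u / PI) * sin u) - 2 * rho_defect u) <= 2 * u ^ 3).
  { apply (power_bound_from_derivative
             (fun s => s * ((1 - s / PI) * sin s) - 2 * rho_defect s) dchi); try lra.
    - unfold rho_defect. rewrite sin_0, cos_0. field. lra.
    - intros r _. unfold dchi, rho_defect. auto_derive; auto. field. lra.
    - intros r Hr. apply Hd; lra. }
  assert (Hp : 0 < u ^ 3) by (apply pow_lt; lra).
  unfold Rdiv at 1.
  rewrite Rabs_mult, Rabs_inv, (Rabs_pos_eq (u ^ 3)) by lra.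
  apply (Rmult_le_reg_r (u ^ 3)); [lra|].
  rewrite Rmult_assoc, Rinv_l, Rmult_1_r by lra. exact Hchi.
Qed.

Lemma defect_ratio_lipschitz (u v : R) :
  0 < u <= v -> v <= PI -> Rabs (defect_ratio v - defect_ratio u) <= 2 * (v - u).
Proof.
  intros Hu Hv.
  destruct (mean_value defect_ratio
    (fun u => (u * ((1 - u / PI) * sin u) - 2 * rho_defect u) / u ^ 3) u v) as [c [Hc E]].
  - lra.
  - intros x Hx. assert (HP := PI_RGT_0). unfold defect_ratio, rho_defect.
    auto_derive; [nra|]. field. lra.
  - rewrite E, Rabs_mult, (Rabs_pos_eq (v - u)) by lra.
    apply Rmult_le_compat_r; [lra|]. apply defect_ratio_derivative_bound; lra.
Qed.

Lemma is_derive_defect_primitive (u : R) :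
  0 < u -> is_derive defect_primitive u (defect_ratio u).
Proof.
  intros Hu. assert (HP := PI_RGT_0).
  replace (defect_ratio u) with
    ((rho_defect u / u ^ 2 - ((1 - u / PI) * sin u) / u - sin u / PI) + sinc u).
  2:{ rewrite sinc_neq0 by lra. unfold defect_ratio. field. lra. }
  apply (is_derive_plus (V := R_NormedModule) (fun u => - rho_defect u / u - (1 - cos u) / PI));
    [|apply is_derive_Si].
  unfold rho_defect. auto_derive; [lra|]. field. lra.
Qed.

Lemma defect_primitive_small (u : R) :
  0 < u <= PI -> Rabs (defect_primitive u) <= 3 * u.
Proof.
  intros Hu. assert (HP := PI_RGT_0). assert (HP3 : 2 <= PI) by (assert (H := PI2_1); lra).
  assert (H1 : Rabs (rho_defect u / u) <= u).
  { unfold Rdiv. rewrite Rabs_mult, Rabs_inv, (Rabs_pos_eq u) by lra.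
    apply (Rmult_le_reg_r u); [lra|].
    rewrite Rmult_assoc, Rinv_l, Rmult_1_r by lra.
    assert (H := rho_defect_bound u ltac:(lra)). nra. }
  assert (H2 := Si_bound u ltac:(lra)).
  assert (H3 : Rabs ((1 - cos u) / PI) <= u).
  { unfold Rdiv. rewrite Rabs_mult, Rabs_inv, (Rabs_pos_eq PI) by lra.
    apply (Rmult_le_reg_r PI); [lra|].
    rewrite Rmult_assoc, Rinv_l, Rmult_1_r by lra.
    assert (H := one_minus_cos_le_id u ltac:(lra)). nra. }
  unfold defect_primitive.
  apply Rabs_le_between in H1; apply Rabs_le_between in H2; apply Rabs_le_between in H3.
  apply Rabs_le.
  replace (- rho_defect u / u) with (- (rho_defect u / u)) by (field; lra).
  lra.
Qed.

(** Midpoint rule on one cell of width [2h]; the Lipschitz bound on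
    [defect_ratio] is enough, since an error of order [h ^ 2] per cell is all
    that is needed. *)
Lemma defect_midpoint (u h : R) :
  0 < h -> 0 < u - h -> u + h <= PI ->
  Rabs (defect_primitive (u + h) - defect_primitive (u - h) - 2 * h * defect_ratio u)
  <= 4 * h ^ 2.
Proof.
  intros Hh Hl Hr.
  destruct (mean_value defect_primitive defect_ratio (u - h) (u + h)) as [c [Hc E]].
  - lra.
  - intros x Hx. apply is_derive_defect_primitive; lra.
  - rewrite E.
    replace (defect_ratio c * (u + h - (u - h)) - 2 * h * defect_ratio u)
      with ((2 * h) * (defect_ratio c - defect_ratio u)) by ring.
    rewrite Rabs_mult, (Rabs_pos_eq (2 * h)) by lra.
    assert (Rabs (defect_ratio c - defect_ratio u) <= 2 * h).
    { destruct (Rle_dec u c).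
      - apply Rle_trans with (2 * (c - u)); [apply defect_ratio_lipschitz|]; lra.
      - rewrite Rabs_minus_sym.
        apply Rle_trans with (2 * (u - c)); [apply defect_ratio_lipschitz|]; lra. }
    nra.
Qed.

(** The odd multiples of [h] are the midpoints of consecutive cells of width
    [2h]. On the first cell, which touches the removable singularity at [0], the
    primitive and the midpoint term are bounded separately. *)
Lemma defect_riemann_sum (h : R) (q : nat) :
  0 < h -> INR (2 * q + 2) * h <= PI ->
  Rabs (defect_primitive (INR (2 * q + 2) * h)
        - 2 * h * sum_n_m (fun k => defect_ratio (INR (2 * k + 1) * h)) 0 q)
  <= 8 * h + 4 * h ^ 2 * INR q.
Proof.
  intros Hh. induction q as [|q IH]; intros Hq.
  - rewrite rsum_one. simpl INR in *.
    rewrite Rmult_1_l. replace ((1 + 1) * h) with (2 * h) in * by ring.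
    assert (H1 := defect_primitive_small (2 * h) ltac:(lra)).
    assert (H2 := defect_ratio_bound h ltac:(lra)).
    apply Rabs_le_between in H1; apply Rabs_le_between in H2. apply Rabs_le. nra.
  - rewrite rsum_last by lia.
    replace (INR (2 * S q + 2)) with (INR (2 * q + 2) + 2) in *.
    2:{ replace (2 * S q + 2)%nat with (S (S (2 * q + 2))) by lia. rewrite !S_INR. ring. }
    replace (INR (2 * S q + 1)) with (INR (2 * q + 2) + 1).
    2:{ replace (2 * S q + 1)%nat with (S (2 * q + 2)) by lia. rewrite !S_INR. ring. }
    rewrite (S_INR q).
    set (v := INR (2 * q + 2)) in *.
    assert (Hv : 0 < v) by (unfold v; apply lt_0_INR; lia).
    specialize (IH ltac:(nra)).
    assert (Hm := defect_midpoint ((v + 1) * h) h Hh).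
    replace ((v + 1) * h + h) with ((v + 2) * h) in Hm by ring.
    replace ((v + 1) * h - h) with (v * h) in Hm by ring.
    specialize (Hm ltac:(nra) ltac:(nra)).
    set (Z := sum_n_m _ 0 q) in *.
    apply Rabs_le_between in IH; apply Rabs_le_between in Hm. apply Rabs_le. nra.
Qed.

(** * Sums over odd indices *)

Lemma PI_ge_3 : 3 <= PI.
Proof. assert (H := PI2_3_2). lra. Qed.

Lemma rsum_abs_le (u v : nat -> R) (n m : nat) :
  (forall k, (n <= k <= m)%nat -> Rabs (u k) <= v k) ->
  Rabs (sum_n_m u n m) <= sum_n_m v n m.
Proof.
  intros H.
  assert (Hm : forall p, (p <= m)%nat -> Rabs (sum_n_m u n p) <= sum_n_m v n p).
  { induction p as [|p IH]; intros Hp.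
    - destruct n as [|n].
      + rewrite !rsum_one. apply H; lia.
      + rewrite !rsum_empty by lia. rewrite Rabs_R0; lra.
    - destruct (Nat.le_gt_cases n (S p)).
      + rewrite !rsum_last by lia.
        apply Rle_trans with (1 := Rabs_triang _ _).
        apply Rplus_le_compat; [apply IH; lia | apply H; lia].
      + rewrite !rsum_empty by lia. rewrite Rabs_R0; lra. }
  apply Hm; lia.
Qed.

Definition odd_recip_squares (q : nat) : R :=
  sum_n_m (fun k => 1 / INR (2 * k + 1) ^ 2) 0 q.

Lemma odd_recip_squares_S (q : nat) :
  odd_recip_squares (S q) = odd_recip_squares q + 1 / (2 * INR q + 3) ^ 2.
Proof.
  unfold odd_recip_squares. rewrite rsum_last by lia.
  replace (INR (2 * S q + 1)) with (2 * INR q + 3); [reflexivity|].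
  rewrite plus_INR, mult_INR, (S_INR q). simpl. ring.
Qed.

(** This lemma and the next enclose the tail of the series: a correction that
    shrinks faster (respectively slower) than the terms are added makes the
    corrected partial sums decreasing (respectively increasing). *)
Lemma odd_recip_squares_upper_decr (q : nat) :
  odd_recip_squares (S q) + 1 / (4 * INR (S q) + 4) <=
  odd_recip_squares q + 1 / (4 * INR q + 4).
Proof.
  rewrite odd_recip_squares_S, S_INR. assert (Hq := pos_INR q). set (x := INR q) in *.
  enough (0 <= 1 / (4 * x + 4) - 1 / (4 * (x + 1) + 4) - 1 / (2 * x + 3) ^ 2) by lra.
  replace (1 / (4 * x + 4) - 1 / (4 * (x + 1) + 4) - 1 / (2 * x + 3) ^ 2)
    with (4 / ((4 * x + 4) * (4 * (x + 1) + 4) * (2 * x + 3) ^ 2)) by (field; nra).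
  apply Rlt_le, Rdiv_lt_0_compat; [lra|].
  repeat apply Rmult_lt_0_compat; nra.
Qed.

Lemma odd_recip_squares_lower_incr (q : nat) :
  odd_recip_squares q + 1 / (4 * INR q + 6) <=
  odd_recip_squares (S q) + 1 / (4 * INR (S q) + 6).
Proof.
  rewrite odd_recip_squares_S, S_INR. assert (Hq := pos_INR q). set (x := INR q) in *.
  enough (0 <= 1 / (2 * x + 3) ^ 2 - (1 / (4 * x + 6) - 1 / (4 * (x + 1) + 6))) by lra.
  replace (1 / (2 * x + 3) ^ 2 - (1 / (4 * x + 6) - 1 / (4 * (x + 1) + 6)))
    with (2 / ((2 * x + 3) ^ 2 * (2 * x + 5))) by (field; nra).
  apply Rlt_le, Rdiv_lt_0_compat; [lra|].
  apply Rmult_lt_0_compat; nra.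
Qed.

Lemma odd_recip_squares_bound (q : nat) : odd_recip_squares q <= 5 / 4.
Proof.
  assert (H : odd_recip_squares q + 1 / (4 * INR q + 4) <= 5 / 4).
  { induction q as [|q IH].
    - unfold odd_recip_squares. rewrite rsum_one. simpl. lra.
    - apply Rle_trans with (2 := IH). apply odd_recip_squares_upper_decr. }
  assert (Hq := pos_INR q).
  assert (0 < 1 / (4 * INR q + 4)) by (apply Rdiv_lt_0_compat; lra).
  lra.
Qed.

Lemma mesh_bounds (n : nat) : 0 < mesh n <= PI / 2.
Proof.
  assert (H := mesh_spec n). assert (Hn := pos_INR n). assert (HP := PI_ge_3).
  assert (0 < mesh n) by (apply Rdiv_lt_0_compat; lra). nra.
Qed.

(** The only deviation of [rho] from its profile comes from [h cot h <> 1], and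
    it is of order [h ^ 2]. *)
Lemma one_minus_rho (j n : nat) :
  1 - rho j n =
  rho_defect (INR j * mesh n) - (mesh n * cot (mesh n) - 1) / PI * sin (INR j * mesh n).
Proof.
  assert (Hn := pos_INR n). assert (HP := PI_RGT_0).
  unfold rho, rho_defect.
  replace (INR j * PI / (INR n + 2)) with (INR j * mesh n) by (unfold mesh; field; lra).
  fold (mesh n). set (c := cot (mesh n)). set (x := cos _). set (y := sin _).
  unfold mesh. field. lra.
Qed.

Lemma rho_1 (n : nat) : rho 1 n = cos (mesh n).
Proof.
  assert (Hn := pos_INR n). assert (Hs := sin_mesh_pos n).
  unfold rho, cot. simpl (INR 1). rewrite !Rmult_1_l. fold (mesh n).
  field. lra.
Qed.

Definition odd_defect_sum (n q : nat) : R :=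
  sum_n_m (fun k => (1 - rho (2 * k + 1) n) / INR (2 * k + 1) ^ 2) 0 q.

(** Up to the cotangent correction, the sum is [h / 2] times a midpoint sum of
    [defect_ratio], hence close to [h / 2] times [defect_primitive PI], whose
    value is [Si PI - 3 / PI]. *)
Lemma odd_defect_sum_asymptotics (n q : nat) :
  (2 * q + 1 <= n <= 2 * q + 2)%nat ->
  Rabs (odd_defect_sum n q - mesh n / 2 * (Si PI - 3 / PI)) <= 12 * mesh n ^ 2.
Proof.
  intros Hn. set (h := mesh n).
  assert (HP := PI_ge_3). assert (HP4 := PI_4).
  assert (Hh : 0 < h <= PI / 2) by apply mesh_bounds.
  assert (Hmesh : (INR n + 2) * h = PI) by apply mesh_spec.
  assert (Hn1 : 2 * INR q + 1 <= INR n <= 2 * INR q + 2).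
  { replace (2 * INR q + 1) with (INR (2 * q + 1)) by (rewrite plus_INR, mult_INR; simpl; ring).
    replace (2 * INR q + 2) with (INR (2 * q + 2)) by (rewrite plus_INR, mult_INR; simpl; ring).
    split; apply le_INR; lia. }
  assert (Hq := pos_INR q).
  set (eps := (h * cot h - 1) / PI).
  assert (Heps : Rabs eps <= 2 * h ^ 2).
  { unfold eps, Rdiv. rewrite Rabs_mult, Rabs_inv, (Rabs_pos_eq PI) by lra.
    apply (Rmult_le_reg_r PI); [lra|].
    rewrite Rmult_assoc, Rinv_l, Rmult_1_r by lra.
    assert (H := cot_expansion h Hh). nra. }
  set (Z := sum_n_m (fun k => defect_ratio (INR (2 * k + 1) * h)) 0 q).
  set (W := sum_n_m (fun k => sin (INR (2 * k + 1) * h) / INR (2 * k + 1) ^ 2) 0 q).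
  assert (Hsplit : odd_defect_sum n q = h ^ 2 * Z - eps * W).
  { unfold odd_defect_sum.
    rewrite (rsum_ext _ (fun k => h ^ 2 * defect_ratio (INR (2 * k + 1) * h)
       + (- eps) * (sin (INR (2 * k + 1) * h) / INR (2 * k + 1) ^ 2))).
    - rewrite rsum_plus, !rsum_scal. fold Z W. ring.
    - intros k _. rewrite one_minus_rho. fold h. fold eps. unfold defect_ratio.
      field. repeat split; (lra || (apply not_0_INR; lia)). }
  assert (HW : Rabs W <= 5 / 4).
  { apply Rle_trans with (2 := odd_recip_squares_bound q).
    apply rsum_abs_le. intros k _.
    assert (Hk : 0 < INR (2 * k + 1) ^ 2) by (apply pow_lt, lt_0_INR; lia).
    unfold Rdiv. rewrite Rabs_mult, Rabs_inv, (Rabs_pos_eq (_ ^ 2)) by lra.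
    apply Rmult_le_compat_r; [left; now apply Rinv_0_lt_compat|].
    apply Rabs_le, SIN_bound. }
  assert (Hlast : INR (2 * q + 2) = 2 * INR q + 2) by (rewrite plus_INR, mult_INR; simpl; ring).
  (* Right end of the last cell; it misses [PI] by at most one cell. *)
  set (e := INR (2 * q + 2) * h).
  assert (He : 0 < e <= PI /\ PI - e <= 2 * h).
  { unfold e. rewrite Hlast. nra. }
  assert (HR : Rabs (defect_primitive e - 2 * h * Z) <= 8 * h + 4 * h ^ 2 * INR q).
  { apply defect_riemann_sum; [lra|]. apply He. }
  assert (HT : Rabs (defect_primitive PI - defect_primitive e) <= 2 * h).
  { destruct (mean_value defect_primitive defect_ratio e PI) as [c [Hc E]]; [lra| |].
    - intros x Hx. apply is_derive_defect_primitive; lra.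
    - rewrite E, Rabs_mult, (Rabs_pos_eq (PI - e)) by lra.
      assert (H1 := defect_ratio_bound c ltac:(lra)). assert (H0 := Rabs_pos (defect_ratio c)).
      nra. }
  assert (HG : defect_primitive PI = Si PI - 3 / PI).
  { unfold defect_primitive, rho_defect. rewrite sin_PI, cos_PI. field. lra. }
  rewrite <- HG, Hsplit.
  assert (HeW : Rabs (eps * W) <= 3 * h ^ 2).
  { rewrite Rabs_mult. assert (H0 := Rabs_pos eps). assert (H1 := Rabs_pos W). nra. }
  assert (Hhq : h ^ 2 * INR q <= 2 * h).
  { assert (h * INR q <= 2) by nra. nra. }
  apply Rabs_le_between in HR; apply Rabs_le_between in HT; apply Rabs_le_between in HeW.
  apply Rabs_le. set (P0 := defect_primitive PI) in *. set (P1 := defect_primitive e) in *.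
  set (V := eps * W) in *.
  assert (HZ : - (18 * h) <= 2 * h * Z - P0 <= 18 * h) by lra.
  replace (h ^ 2 * Z - V - h / 2 * P0) with (h / 2 * (2 * h * Z - P0) - V) by field.
  nra.
Qed.

(** * The first absolute moment of the kernel *)

Lemma last_odd_index (n : nat) :
  (1 <= n)%nat -> exists q, (2 * q + 1 <= n <= 2 * q + 2)%nat.
Proof.
  intros Hn. destruct (Nat.Even_or_Odd n) as [[k Hk]|[k Hk]].
  - exists (k - 1)%nat. lia.
  - exists k. lia.
Qed.

Definition kernel_abs_moment (n : nat) : R :=
  RInt (fun t => Rabs t * cos_poly (fun j => rho j n) n t) (- PI) PI.

Lemma is_RInt_kernel_abs_moment (n : nat) :
  (1 <= n)%nat ->
  is_RInt (fun t => Rabs t * cos_poly (fun j => rho j n) n t) (- PI) PI (kernel_abs_moment n).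
Proof.
  intros Hn. apply (RInt_correct (V := R_CompleteNormedModule)).
  destruct (last_odd_index n Hn) as [q Hq].
  eexists. apply (is_RInt_cos_poly_abs _ n q Hq).
Qed.

(** The closed form of the moment, rearranged so that both summands tend to
    [0]. *)
Lemma kernel_abs_moment_split (n q : nat) :
  (2 * q + 1 <= n <= 2 * q + 2)%nat ->
  kernel_abs_moment n = 4 * (PI ^ 2 / 8 - odd_recip_squares q + odd_defect_sum n q).
Proof.
  intros Hn.
  assert (H := is_RInt_cos_poly_abs (fun j => rho j n) n q Hn).
  apply (is_RInt_unique (V := R_CompleteNormedModule)) in H.
  unfold kernel_abs_moment. rewrite H.
  enough (@eq R (sum_n_m (fun k => rho (2 * k + 1) n / INR (2 * k + 1) ^ 2) 0 q)
                (odd_recip_squares q - odd_defect_sum n q)) as -> by field.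
  unfold odd_recip_squares, odd_defect_sum.
  rewrite (rsum_ext (fun k => rho (2 * k + 1) n / INR (2 * k + 1) ^ 2)
    (fun k => 1 / INR (2 * k + 1) ^ 2
              + (-1) * ((1 - rho (2 * k + 1) n) / INR (2 * k + 1) ^ 2))).
  - rewrite rsum_plus, rsum_scal. unfold Rminus. ring.
  - intros k _. field. apply not_0_INR; lia.
Qed.

(** A rough rate obtained without any summation: integrate
    [|t| <= h / 2 + (16 / h) (1 - cos t)] against the kernel, using that
    [1 - cos t] has integral [PI (1 - cos h)], of order [h ^ 2]. The lower bound
    and the upper bound both rest on the nonnegativity of the kernel. *)
Lemma kernel_abs_moment_bounds (n : nat) :
  (1 <= n)%nat -> 0 <= kernel_abs_moment n <= 17 * PI * mesh n.
Proof.
  intros Hn. set (h := mesh n).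
  assert (HP := PI_ge_3). assert (Hh : 0 < h <= PI / 2) by apply mesh_bounds.
  assert (HI := is_RInt_kernel_abs_moment n Hn).
  set (K := cos_poly (fun j => rho j n) n) in *.
  assert (HK : forall t, 0 <= K t) by apply rivlin_kernel_nonneg.
  split.
  - apply (is_RInt_ge_0 (fun t => Rabs t * K t) (- PI) PI); [lra|exact HI|].
    intros t _. apply Rmult_le_pos; [apply Rabs_pos|apply HK].
  - assert (H1 := is_RInt_cos_poly_total (fun j => rho j n) n).
    assert (H2 := is_RInt_cos_poly_cos (fun j => rho j n) n Hn).
    cbv beta in H2. rewrite rho_1 in H2. fold h in H2. fold K in H1, H2.
    assert (H3 := is_RInt_plus_R _ _ _ _ _ _
      (is_RInt_scal_R _ _ _ (h / 2 + 16 / h) _ H1) (is_RInt_scal_R _ _ _ (- (16 / h)) _ H2)).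
    apply Rle_trans with ((h / 2 + 16 / h) * PI + - (16 / h) * (PI * cos h)).
    + apply (is_RInt_le (fun t => Rabs t * K t)
        (fun t => (h / 2 + 16 / h) * K t + - (16 / h) * (cos t * K t)) (- PI) PI);
        [lra|exact HI|exact H3|].
      intros t Ht.
      replace ((h / 2 + 16 / h) * K t + - (16 / h) * (cos t * K t))
        with ((h / 2 + 16 / h * (1 - cos t)) * K t) by ring.
      apply Rmult_le_compat_r; [apply HK|].
      assert (Hc := sqr_le_one_minus_cos t ltac:(lra)).
      apply (Rmult_le_reg_l (2 * h)); [lra|].
      replace (2 * h * (h / 2 + 16 / h * (1 - cos t))) with (h ^ 2 + 32 * (1 - cos t))
        by (field; lra).
      apply Rle_trans with (h ^ 2 + t ^ 2); [|lra].
      (* [2 h |t| <= h ^ 2 + t ^ 2]. *)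
      assert (Hsq := pow2_ge_0 (h - Rabs t)). rewrite <- (pow2_abs t). lra.
    + assert (Hc := one_minus_cos_le h ltac:(lra)).
      apply Rabs_le_between in Hc.
      replace ((h / 2 + 16 / h) * PI + - (16 / h) * (PI * cos h))
        with (PI * (h / 2 + 16 / h * (1 - cos h))) by ring.
      replace (17 * PI * h) with (PI * (17 * h)) by ring.
      apply Rmult_le_compat_l; [lra|].
      apply Rle_trans with (h / 2 + 16 / h * h ^ 2).
      * apply Rplus_le_compat_l, Rmult_le_compat_l; [|lra].
        apply Rlt_le, Rdiv_lt_0_compat; lra.
      * replace (16 / h * h ^ 2) with (16 * h) by (field; lra). lra.
Qed.

Lemma is_lim_seq_of_rate (u : nat -> R) (l C : R) :
  (forall q, Rabs (u q - l) <= C / INR (S q)) -> is_lim_seq u l.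
Proof.
  intros H.
  assert (Hz : is_lim_seq (fun q => C / INR (S q)) 0).
  { replace (Finite 0) with (Rbar_mult C 0) by (simpl; f_equal; ring).
    apply (is_lim_seq_scal_l (fun q => / INR (S q)) C 0).
    apply (is_lim_seq_incr_1 (fun q => / INR q)).
    replace (Finite 0) with (Rbar_inv p_infty) by reflexivity.
    apply is_lim_seq_inv; [apply is_lim_seq_INR|discriminate]. }
  apply (is_lim_seq_le_le (fun q => l + - (C / INR (S q))) u (fun q => l + C / INR (S q))).
  - intros q. specialize (H q). apply Rabs_le_between in H. lra.
  - replace (Finite l) with (Finite (l + - 0)) by (f_equal; ring).
    apply is_lim_seq_plus'; [apply is_lim_seq_const|].
    apply (is_lim_seq_opp (fun q => C / INR (S q)) 0). exact Hz.
  - replace (Finite l) with (Finite (l + 0)) by (f_equal; ring).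
    apply is_lim_seq_plus'; [apply is_lim_seq_const|exact Hz].
Qed.

(** The value [PI ^ 2 / 8] of the sum of the inverse odd squares, with a rate: by
    [kernel_abs_moment_split], the remainder is a quarter of the moment minus the
    defect sum, and both are already known to be [O(h)]. *)
Lemma odd_recip_squares_rate (q : nat) :
  Rabs (odd_recip_squares q - PI ^ 2 / 8) <= 300 / INR (S q).
Proof.
  set (n := (2 * q + 1)%nat). set (h := mesh n).
  assert (HP := PI_ge_3). assert (HP4 := PI_4). assert (Hq := pos_INR q).
  assert (Hh : 0 < h <= PI / 2) by apply mesh_bounds.
  assert (HJ := kernel_abs_moment_bounds n ltac:(lia)). fold h in HJ.
  rewrite (kernel_abs_moment_split n q) in HJ by lia.
  assert (HA := odd_defect_sum_asymptotics n q ltac:(lia)). fold h in HA.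
  assert (HS := Si_bound PI ltac:(lra)).
  assert (H3 : 0 <= 3 / PI <= 1).
  { split; [apply Rlt_le, Rdiv_lt_0_compat; lra|].
    apply (Rmult_le_reg_r PI); [lra|]. unfold Rdiv. rewrite Rmult_assoc, Rinv_l; lra. }
  apply Rabs_le_between in HA. apply Rabs_le_between in HS.
  (* For [n = 2q + 1], [h = PI / (2q + 3)]. *)
  assert (Hrate : h <= 2 / INR (S q)).
  { assert (Hm := mesh_spec n). fold h in Hm. unfold n in Hm.
    rewrite plus_INR, mult_INR in Hm. simpl in Hm. rewrite S_INR.
    apply (Rmult_le_reg_r (INR q + 1)); [lra|].
    unfold Rdiv. rewrite Rmult_assoc, Rinv_l by lra. nra. }
  apply Rle_trans with (150 * h).
  - apply Rabs_le. set (s := Si PI - 3 / PI) in *.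
    assert (Hs : -5 <= s <= 4) by (unfold s; lra).
    assert (-(5/2 * h) <= h / 2 * s <= 2 * h) by nra.
    assert (h ^ 2 <= 2 * h) by nra.
    assert (PI * h <= 4 * h) by nra.
    lra.
  - unfold Rdiv in *. lra.
Qed.

(** A convergent monotone sequence lies on one side of its limit. *)
Lemma odd_recip_squares_tail (q : nat) :
  1 / (4 * INR q + 6) <= PI ^ 2 / 8 - odd_recip_squares q <= 1 / (4 * INR q + 4).
Proof.
  assert (Hlim : forall c, 4 <= c ->
    is_lim_seq (fun q => odd_recip_squares q + 1 / (4 * INR q + c)) (PI ^ 2 / 8)).
  { intros c Hc. apply (is_lim_seq_of_rate _ _ 301). intros p.
    assert (H := odd_recip_squares_rate p). assert (Hp := pos_INR p).
    assert (H1 : 0 <= 1 / (4 * INR p + c) <= 1 / INR (S p)).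
    { split; [apply Rlt_le, Rdiv_lt_0_compat; lra|].
      rewrite S_INR. unfold Rdiv. rewrite !Rmult_1_l.
      apply Rinv_le_contravar; lra. }
    apply Rabs_le_between in H. apply Rabs_le. unfold Rdiv in *. lra. }
  assert (Hlo := is_lim_seq_incr_compare _ _ (Hlim 6 ltac:(lra)) odd_recip_squares_lower_incr q).
  assert (Hup := is_lim_seq_decr_compare _ _ (Hlim 4 ltac:(lra)) odd_recip_squares_upper_decr q).
  simpl in Hlo, Hup. lra.
Qed.

(** With [N = n + 2], the tail of the series contributes [1 / (2 N)] and the
    defect sum [(PI Si(PI) - 3) / (2 N)]; multiplied by [4 / PI], their sum is
    [(2 Si(PI) - 4 / PI) / N]. *)
Lemma kernel_abs_moment_asymptotics (n : nat) :
  (1 <= n)%nat ->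
  Rabs (kernel_abs_moment n / PI - Rivlin_const * (1 / (INR n + 2)))
  <= 300 / (INR n + 2) ^ 2.
Proof.
  intros Hn1.
  destruct (last_odd_index n Hn1) as [q Hn].
  rewrite (kernel_abs_moment_split n q Hn), Rivlin_const_Si.
  assert (HA := odd_defect_sum_asymptotics n q Hn).
  assert (HT := odd_recip_squares_tail q).
  assert (HP := PI_ge_3). assert (HP4 := PI_4). assert (Hq0 := pos_INR q).
  assert (Hnq : 2 * INR q + 1 <= INR n <= 2 * INR q + 2).
  { replace (2 * INR q + 1) with (INR (2 * q + 1)) by (rewrite plus_INR, mult_INR; simpl; ring).
    replace (2 * INR q + 2) with (INR (2 * q + 2)) by (rewrite plus_INR, mult_INR; simpl; ring).
    split; apply le_INR; lia. }
  set (N := INR n + 2) in *.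
  assert (HN : 3 <= N) by (unfold N; lra).
  assert (HN2 : 0 < 1 / N ^ 2) by (apply Rdiv_lt_0_compat; nra).
  assert (Htail : 0 <= PI ^ 2 / 8 - odd_recip_squares q - 1 / (2 * N) <= 3 * (1 / N ^ 2)).
  { assert (Hlow : 1 / (2 * N) <= 1 / (4 * INR q + 6)).
    { unfold Rdiv. rewrite !Rmult_1_l. apply Rinv_le_contravar; unfold N; lra. }
    assert (Hup : 1 / (4 * INR q + 4) <= 1 / (2 * N) + 3 * (1 / N ^ 2)).
    { apply Rle_trans with (1 / (2 * N - 4)).
      - unfold Rdiv. rewrite !Rmult_1_l. apply Rinv_le_contravar; unfold N; lra.
      - apply Rminus_le.
        replace (1 / (2 * N - 4) - (1 / (2 * N) + 3 * (1 / N ^ 2)))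
          with (- ((2 * N - 6) / (N ^ 2 * (N - 2)))) by (field; lra).
        assert (0 <= (2 * N - 6) / (N ^ 2 * (N - 2))); [|lra].
        apply Rdiv_le_0_compat; nra. }
    lra. }
  replace (mesh n ^ 2) with (PI ^ 2 * (1 / N ^ 2)) in HA by (unfold mesh; fold N; field; lra).
  replace (mesh n / 2 * (Si PI - 3 / PI)) with ((PI * Si PI - 3) / (2 * N)) in HA
    by (unfold mesh; fold N; field; lra).
  replace (300 / N ^ 2) with (300 * (1 / N ^ 2)) by (field; lra).
  set (A := odd_defect_sum n q) in *.
  set (tau := PI ^ 2 / 8 - odd_recip_squares q) in *.
  replace (4 * (tau + A) / PI - (2 * Si PI - 4 / PI) * (1 / N))
    with ((4 * ((tau - 1 / (2 * N)) + (A - (PI * Si PI - 3) / (2 * N)))) / PI)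
    by (field; lra).
  set (v := 1 / N ^ 2) in *.
  apply Rabs_le_between in HA.
  unfold Rdiv at 1. rewrite Rabs_mult, Rabs_inv, (Rabs_pos_eq PI) by lra.
  apply (Rmult_le_reg_r PI); [lra|].
  rewrite Rmult_assoc, Rinv_l, Rmult_1_r by lra.
  apply Rabs_le.
  set (x := tau - 1 / (2 * N)) in *. set (y := A - _) in *.
  assert (PI ^ 2 * v <= 4 * PI * v) by nra.
  nra.
Qed.

(** * The error of the convolution *)

Lemma integral_R_supported (g : R -> R) (a b v : R) :
  a <= b -> (forall t, t < a \/ b < t -> g t = 0) ->
  is_RInt g a b v -> integral_R g = v.
Proof.
  intros Hab Hout Hin.
  assert (Hzero : forall c d, c <= d -> d <= a \/ b <= c -> is_RInt g c d 0).
  { intros c d Hcd Hd.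
    apply (is_RInt_ext (fun _ => 0)).
    - intros t Ht. rewrite Rmin_left, Rmax_right in Ht by lra.
      symmetry; apply Hout; lra.
    - assert (H0 := is_RInt_const (V := R_NormedModule) c d 0).
      change (is_RInt (fun _ : R => 0) c d ((d - c) * 0)) in H0.
      rewrite Rmult_0_r in H0.
      exact H0. }
  unfold integral_R.
  apply (is_RInt_gen_unique (V := R_CompleteNormedModule)).
  intros P [e He].
  apply (Filter_prod _ _ _ (fun c => c < a) (fun d => b < d)).
  - exists a; auto.
  - exists b; auto.
  - intros c d Hc Hd. exists v. simpl. split.
    + replace v with (plus 0 (plus v 0)) by (unfold plus; simpl; ring).
      apply (is_RInt_Chasles (V := R_NormedModule) g c a d).
      * apply Hzero; lra.
      * apply (is_RInt_Chasles (V := R_NormedModule) g a b d); [exact Hin|].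
        apply Hzero; lra.
    + apply He, ball_center.
Qed.

Lemma continuous_cos_poly (c : nat -> R) (n : nat) (t : R) : continuous (cos_poly c n) t.
Proof.
  apply (continuous_plus (V := R_NormedModule) (fun _ => 1 / 2)); [apply continuous_const|].
  induction n as [|n IH].
  - apply (continuous_ext (fun _ => 0)); [|apply continuous_const].
    intros s. symmetry. apply rsum_empty; lia.
  - apply (continuous_ext (fun s => sum_n_m (fun j => c j * cos (INR j * s)) 1 n
                                    + c (S n) * cos (INR (S n) * s))).
    { intros s. symmetry. apply (rsum_last (fun j => c j * cos (INR j * s))). lia. }
    apply (continuous_plus (V := R_NormedModule)); [exact IH|].
    apply (ex_derive_continuous (V := R_NormedModule)). auto_derive; auto.
Qed.

Lemma Lipschitz_continuous (L : R) (f : R -> R) (x : R) :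
  0 < L -> Lipschitz L f -> continuous f x.
Proof.
  intros HL Hf. apply continuity_pt_filterlim. intros e He.
  exists (e / L). split; [apply Rdiv_lt_0_compat; lra|].
  intros y [_ Hy]. simpl in *. unfold Rdist in *.
  apply Rle_lt_trans with (1 := Hf y x).
  apply Rlt_le_trans with (L * (e / L)); [apply Rmult_lt_compat_l; lra|].
  right. field. lra.
Qed.

Lemma indicator_in (a b t : R) : a <= t <= b -> indicator a b t = 1.
Proof.
  intros Ht. unfold indicator. destruct (Rle_dec a t), (Rle_dec t b); lra.
Qed.

Lemma indicator_out (a b t : R) : t < a \/ b < t -> indicator a b t = 0.
Proof.
  intros Ht. unfold indicator. destruct (Rle_dec a t), (Rle_dec t b); lra.
Qed.

Lemma Rivlin_in (n : nat) (t : R) :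
  - PI <= t <= PI -> Rivlin n t = cos_poly (fun j => rho j n) n t.
Proof. intros Ht. unfold Rivlin. rewrite indicator_in by exact Ht. apply Rmult_1_r. Qed.

Lemma Rivlin_out (n : nat) (t : R) : t < - PI \/ PI < t -> Rivlin n t = 0.
Proof. intros Ht. unfold Rivlin. rewrite indicator_out by exact Ht. apply Rmult_0_r. Qed.

Lemma integral_Rivlin (n : nat) : integral_R (Rivlin n) = PI.
Proof.
  assert (HP := PI_RGT_0).
  apply (integral_R_supported _ (- PI) PI); [lra|apply Rivlin_out|].
  apply (is_RInt_ext_R (cos_poly (fun j => rho j n) n)); [|apply is_RInt_cos_poly_total].
  intros t Ht. rewrite Rmin_left, Rmax_right in Ht by lra. symmetry; apply Rivlin_in; lra.
Qed.

(** As the kernel has mean [1], the error is an average of the increments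
    [f x - f (x - t)]. *)
Lemma is_RInt_convolution_error (f : R -> R) (n : nat) (x : R) :
  (forall y, continuous f y) ->
  is_RInt (fun t => (f x - f (x - t)) * cos_poly (fun j => rho j n) n t) (- PI) PI
          (PI * (f x - convolution f (Rivlin_hat n) x)).
Proof.
  intros Hf. assert (HP := PI_RGT_0).
  set (K := cos_poly (fun j => rho j n) n).
  assert (Hex : ex_RInt (fun t => f (x - t) * K t) (- PI) PI).
  { apply (ex_RInt_continuous (V := R_CompleteNormedModule)). intros t _.
    apply (continuous_mult (K := R_AbsRing)); [|apply continuous_cos_poly].
    apply (continuous_comp (fun t => x - t) f); [|apply Hf].
    apply (ex_derive_continuous (V := R_NormedModule)). auto_derive; auto. }
  destruct Hex as [v Hv].
  assert (Hconv : convolution f (Rivlin_hat n) x = / PI * v).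
  { apply (integral_R_supported _ (- PI) PI); [lra| |].
    - intros t Ht. unfold Rivlin_hat. rewrite Rivlin_out by exact Ht. unfold Rdiv. ring.
    - apply (is_RInt_ext_R (fun t => / PI * (f (x - t) * K t))); [|now apply is_RInt_scal_R].
      intros t Ht. rewrite Rmin_left, Rmax_right in Ht by lra.
      unfold Rivlin_hat. rewrite integral_Rivlin, Rivlin_in by lra. fold K. field. lra. }
  rewrite Hconv.
  replace (PI * (f x - / PI * v)) with (f x * PI + -1 * v) by (field; lra).
  apply (is_RInt_ext_R (fun t => f x * K t + -1 * (f (x - t) * K t))); [intros; ring|].
  apply is_RInt_plus_R; apply is_RInt_scal_R; [apply is_RInt_cos_poly_total|exact Hv].
Qed.

Lemma convolution_error_le (L : R) (f : R -> R) (n : nat) (x : R) :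
  0 < L -> Lipschitz L f -> (1 <= n)%nat ->
  Rabs (f x - convolution f (Rivlin_hat n) x) <= L * (kernel_abs_moment n / PI).
Proof.
  intros HL Hf Hn. assert (HP := PI_RGT_0).
  assert (He := is_RInt_convolution_error f n x (fun y => Lipschitz_continuous L f y HL Hf)).
  assert (HJ := is_RInt_scal_R _ _ _ L _ (is_RInt_kernel_abs_moment n Hn)).
  assert (H : Rabs (PI * (f x - convolution f (Rivlin_hat n) x)) <= L * kernel_abs_moment n).
  { apply (norm_RInt_le (V := R_NormedModule) _ _ (- PI) PI _ _ ltac:(lra)) with (2 := He) (3 := HJ).
    intros t _. change norm with Rabs.
    assert (HK := rivlin_kernel_nonneg n t).
    rewrite Rabs_mult, (Rabs_pos_eq (cos_poly _ _ _)) by exact HK.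
    rewrite <- Rmult_assoc. apply Rmult_le_compat_r; [exact HK|].
    apply Rle_trans with (1 := Hf x (x - t)).
    right. do 2 f_equal. ring. }
  rewrite Rabs_mult, (Rabs_pos_eq PI) in H by lra.
  apply (Rmult_le_reg_l PI); [lra|].
  apply Rle_trans with (1 := H). right. field. lra.
Qed.

(** At the kink, every increment equals [- L |t|], so the bound of
    [convolution_error_le] is attained. *)
Lemma convolution_error_triangle (L : R) (f : R -> R) (n : nat) :
  0 < L -> Lipschitz L f -> (forall x, - PI <= x <= PI -> f x = L * Rabs x) ->
  (1 <= n)%nat ->
  Rabs (f 0 - convolution f (Rivlin_hat n) 0) = L * (kernel_abs_moment n / PI).
Proof.
  intros HL Hf Heq Hn. assert (HP := PI_RGT_0).
  assert (He := is_RInt_convolution_error f n 0 (fun y => Lipschitz_continuous L f y HL Hf)).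
  assert (HJ := is_RInt_scal_R _ _ _ (- L) _ (is_RInt_kernel_abs_moment n Hn)).
  assert (H : PI * (f 0 - convolution f (Rivlin_hat n) 0) = - L * kernel_abs_moment n).
  { apply (is_RInt_unique (V := R_CompleteNormedModule)) in HJ. rewrite <- HJ.
    symmetry. apply (is_RInt_unique (V := R_CompleteNormedModule)).
    revert He. apply is_RInt_ext_R. intros t Ht.
    rewrite Rmin_left, Rmax_right in Ht by lra.
    rewrite !Heq, Rabs_R0, Rminus_0_l, Rabs_Ropp by lra. ring. }
  assert (HM := kernel_abs_moment_bounds n Hn).
  replace (f 0 - convolution f (Rivlin_hat n) 0) with (- (L * (kernel_abs_moment n / PI))).
  2:{ apply (Rmult_eq_reg_l PI); [|lra]. rewrite H. field. lra. }
  rewrite Rabs_Ropp. apply Rabs_pos_eq.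
  apply Rmult_le_pos; [lra|]. apply Rdiv_le_0_compat; lra.
Qed.

(** * The triangle wave *)

Lemma periodic_shift (f : R -> R) (k : Z) (x : R) :
  periodic_2PI f -> f (x + IZR k * (2 * PI)) = f x.
Proof.
  intros Hf.
  assert (Hnat : forall (m : nat) (y : R), f (y + INR m * (2 * PI)) = f y).
  { induction m as [|m IH]; intros y.
    - simpl. f_equal. ring.
    - rewrite S_INR.
      replace (y + (INR m + 1) * (2 * PI)) with ((y + INR m * (2 * PI)) + 2 * PI) by ring.
      rewrite Hf. apply IH. }
  destruct (Z_le_gt_dec 0 k) as [Hk|Hk].
  - rewrite <- (Z2Nat.id k), <- INR_IZR_INZ by lia. apply Hnat.
  - rewrite <- (Hnat (Z.to_nat (- k)) (x + IZR k * (2 * PI))).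
    rewrite INR_IZR_INZ, Z2Nat.id, opp_IZR by lia. f_equal. ring.
Qed.

Lemma reduce_mod_2PI (x : R) :
  exists k : Z, - PI <= x + IZR k * (2 * PI) <= PI.
Proof.
  assert (HP := PI_RGT_0).
  set (r := x / (2 * PI) + 1 / 2).
  destruct (archimed r) as [H1 H2].
  exists (1 - up r)%Z. rewrite minus_IZR.
  assert (Hx : x = (r - 1 / 2) * (2 * PI)) by (unfold r; field; lra).
  rewrite Hx. split; nra.
Qed.

(** The wave is [L] times the distance to the nearest multiple of [2 PI]. Hence
    [f z <= L |z|] everywhere, with equality on the central period: shifting
    [y] there by a multiple of [2 PI], and [x] by the same amount, the triangle
    inequality gives [f x - f y <= L |x - y|]. *)
Lemma triangle_wave_Lipschitz (L : R) (f : R -> R) :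
  0 < L -> is_periodic_extension (fun x => L * Rabs x) f -> Lipschitz L f.
Proof.
  intros HL [Hper Hf]. assert (HP := PI_RGT_0).
  assert (Hle : forall z, f z <= L * Rabs z).
  { intros z. destruct (reduce_mod_2PI z) as [k Hk].
    rewrite <- (periodic_shift f k z Hper), Hf by exact Hk.
    apply Rmult_le_compat_l; [lra|].
    set (w := z + IZR k * (2 * PI)) in *.
    assert (Hz : z = w - IZR k * (2 * PI)) by (unfold w; ring).
    destruct (Z.lt_trichotomy k 0) as [Hk0|[Hk0|Hk0]].
    - assert (IZR k <= -1) by (apply IZR_le; lia).
      apply Rle_trans with PI; [now apply Rabs_le|].
      apply Rle_trans with z; [nra|apply Rle_abs].
    - right. f_equal. rewrite Hz, Hk0. ring.
    - assert (1 <= IZR k) by (apply IZR_le; lia).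
      apply Rle_trans with PI; [now apply Rabs_le|].
      rewrite <- Rabs_Ropp. apply Rle_trans with (- z); [nra|apply Rle_abs]. }
  assert (Hone : forall x y, f x - f y <= L * Rabs (x - y)).
  { intros x y. destruct (reduce_mod_2PI y) as [k Hk].
    rewrite <- (periodic_shift f k y Hper), (Hf _ Hk).
    rewrite <- (periodic_shift f k x Hper).
    assert (H := Hle (x + IZR k * (2 * PI))).
    assert (Ht : Rabs (x + IZR k * (2 * PI)) <= Rabs (x - y) + Rabs (y + IZR k * (2 * PI))).
    { replace (x + IZR k * (2 * PI)) with ((x - y) + (y + IZR k * (2 * PI))) by ring.
      apply Rabs_triang. }
    nra. }
  intros x y. apply Rabs_le. split; [|apply Hone].
  assert (H := Hone y x). rewrite Rabs_minus_sym in H. lra.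
Qed.

(** * The error asymptotics *)

(** Replacing [n + 2] by [n] in the main term costs only [O(1 / n ^ 2)]. *)
Lemma bigO_abs_moment_remainder (L : R) :
  0 < L ->
  bigO (fun n => L * (kernel_abs_moment n / PI) - Rivlin_const * (L / INR n))
       (fun n => 1 / INR n ^ 2).
Proof.
  intros HL. exists (L * (300 + 2 * Rabs Rivlin_const)).
  exists 1%nat. intros n Hn.
  assert (H := kernel_abs_moment_asymptotics n Hn).
  assert (Hn1 : 1 <= INR n) by (change 1 with (INR 1); now apply le_INR).
  set (x := INR n) in *. set (c := Rivlin_const) in *.
  assert (Hinv : 0 < 1 / x ^ 2) by (apply Rdiv_lt_0_compat; nra).
  rewrite (Rabs_pos_eq (1 / x ^ 2)) by lra.
  replace (L * (kernel_abs_moment n / PI) - c * (L / x))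
    with (L * ((kernel_abs_moment n / PI - c * (1 / (x + 2)))
               + - c * (1 / x - 1 / (x + 2)))) by (field; assert (HP := PI_RGT_0); lra).
  rewrite Rabs_mult, (Rabs_pos_eq L), !Rmult_assoc by lra.
  apply Rmult_le_compat_l; [lra|].
  apply Rle_trans with (1 := Rabs_triang _ _).
  rewrite Rabs_mult, Rabs_Ropp.
  assert (H1 : 300 / (x + 2) ^ 2 <= 300 * (1 / x ^ 2)).
  { unfold Rdiv. apply Rmult_le_compat_l; [lra|]. rewrite Rmult_1_l.
    apply Rinv_le_contravar; nra. }
  assert (H2 : Rabs (1 / x - 1 / (x + 2)) <= 2 * (1 / x ^ 2)).
  { replace (1 / x - 1 / (x + 2)) with (2 * (1 / (x * (x + 2)))) by (field; lra).
    rewrite Rabs_pos_eq.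
    - apply Rmult_le_compat_l; [lra|]. unfold Rdiv. rewrite !Rmult_1_l.
      apply Rinv_le_contravar; nra.
    - apply Rmult_le_pos; [lra|]. apply Rlt_le, Rdiv_lt_0_compat; nra. }
  assert (H3 := Rabs_pos c).
  nra.
Qed.

Theorem theorem1p3 (L : R) (hL : 0 < L) :
  (exists E : nat -> R,
     bigO E (fun n => 1 / INR n ^ 2) /\
     forall f : R -> R, periodic_2PI f -> Lipschitz L f ->
     forall n : nat, (1 <= n)%nat ->
       Rbar_le (sup_dist f (convolution f (Rivlin_hat n)))
               (Finite (Rivlin_const * (L / INR n) + E n))) /\
  (exists E : nat -> R,
     bigO E (fun n => 1 / INR n ^ 2) /\
     forall f : R -> R,
     is_periodic_extension (fun x => L * Rabs x) f ->
     forall n : nat, (1 <= n)%nat ->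
       sup_dist f (convolution f (Rivlin_hat n)) =
       Finite (Rivlin_const * (L / INR n) + E n)).
Proof.
  set (E := fun n => L * (kernel_abs_moment n / PI) - Rivlin_const * (L / INR n)).
  assert (HE : bigO E (fun n => 1 / INR n ^ 2)) by exact (bigO_abs_moment_remainder L hL).
  assert (Hmain : forall n, Rivlin_const * (L / INR n) + E n = L * (kernel_abs_moment n / PI))
    by (intros n; unfold E; ring).
  assert (Hub : forall f n, Lipschitz L f -> (1 <= n)%nat ->
    is_ub_Rbar (fun y => exists x, y = Rabs (f x - convolution f (Rivlin_hat n) x))
               (Finite (L * (kernel_abs_moment n / PI)))).
  { intros f n Hf Hn y [x ->]. now apply convolution_error_le. }
  split; exists E; (split; [exact HE|]).
  - intros f _ Hf n Hn. rewrite Hmain.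
    apply (proj2 (Lub_Rbar_correct _)). now apply Hub.
  - intros f Hext n Hn. rewrite Hmain.
    assert (Hf := triangle_wave_Lipschitz L f hL Hext).
    apply is_lub_Rbar_unique. split; [now apply Hub|].
    intros b Hb. apply Hb. exists 0.
    symmetry. apply convolution_error_triangle; auto. apply Hext.
Qed.
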